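(* A project with startup costs, in its restless reformulation (as defined in the context), is PCL$(\hat{\mathcal F})$-indexable.
   Context: Project: finite state space $N$ with $n=|N|$, stochastic matrix $(p_{ij})_{i,j\in N}$, active rewards $R_i\in\mathbb{R}$, startup costs $c_i\ge 0$ ($i\in N$), zero shutdown costs, discount factor $0<\beta<1$. Restless reformulation: the discounted Markov decision process with state space $\hat N=\{0,1\}\times N$ (states $(a^-,i)$, where $a^-$ is the previous action) and actions $a\in\{0,1\}$. In state $(a^-,i)$, action $1$ (''engage'') yields reward $R_i-(1-a^-)c_i$ and moves the state to $(1,j)$ with probability $p_{ij}$; action $0$ (''rest'') yields reward $0$ and moves the state to $(0,i)$ with probability $1$. For a policy $\pi$ and initial state $(a^-,i)$, $f^{\pi}_{(a^-,i)}$ is the expected total $\beta$-discounted reward and $g^{\pi}_{(a^-,i)}=\mathsf{E}^{\pi}_{(a^-,i)}[\sum_{t\ge0}a(t)\beta^t]$. For $S_0,S_1\subseteq N$, $S_0\oplus S_1=(\{0\}\times S_0)\cup(\{1\}\times S_1)$; it also denotes the stationary policy that engages exactly in the states of $S_0\oplus S_1$. $\hat{\mathcal F}=\{S_0\oplus S_1:S_0\subseteq S_1\subseteq N\}$. $\langle a,\hat S\rangle$ denotes the policy that takes action $a$ in the initial period and follows policy $\hat S$ thereafter. For $\hat S\in\hat{\mathcal F}$ and $(a^-,i)\in\hat N$ define $$w^{\hat S}_{(a^-,i)}=g^{\langle1,\hat S\rangle}_{(a^-,i)}-g^{\langle0,\hat S\rangle}_{(a^-,i)},\quad r^{\hat S}_{(a^-,i)}=f^{\langle1,\hat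 S\rangle}_{(a^-,i)}-f^{\langle0,\hat S\rangle}_{(a^-,i)},\quad \nu^{\hat S}_{(a^-,i)}=r^{\hat S}_{(a^-,i)}/w^{\hat S}_{(a^-,i)}.$$ Algorithm $\mathrm{AG}_{\hat{\mathcal F}}$: set $\hat S^0=\emptyset$. For $k=1,\dots,2n$: pick (ties broken arbitrarily) $$(a_k^-,i_k)\in\arg\max\{\nu^{\hat S^{k-1}}_{(a^-,i)}:(a^-,i)\in\hat N\setminus\hat S^{k-1},\ \hat S^{k-1}\cup\{(a^-,i)\}\in\hat{\mathcal F}\},$$ set $\nu^*_{(a_k^-,i_k)}=\nu^{\hat S^{k-1}}_{(a_k^-,i_k)}$ and $\hat S^k=\hat S^{k-1}\cup\{(a_k^-,i_k)\}$. The project is PCL$(\hat{\mathcal F})$-indexable if: (i) $w^{\hat S}_{(a^-,i)}>0$ for all $(a^-,i)\in\hat N$ and $\hat S\in\hat{\mathcal F}$; and (ii) the output of algorithm $\mathrm{AG}_{\hat{\mathcal F}}$ satisfies $\nu^*_{(a_1^-,i_1)}\ge\nu^*_{(a_2^-,i_2)}\ge\cdots\ge\nu^*_{(a_{2n}^-,i_{2n})}$. *)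

(* Defs.v *)
From HB Require Import structures.
From mathcomp Require Import all_boot all_order all_algebra.
From mathcomp Require Import reals topology normedtype sequences.

Set Implicit Arguments.
Unset Strict Implicit.
Unset Printing Implicit Defensive.

Import Order.TTheory GRing.Theory Num.Theory.
Import numFieldNormedType.Exports.

Local Open Scope ring_scope.

Definition stochastic (R : realType) (N : finType) (p : N -> N -> R) : Prop :=
  (forall i j, 0 <= p i j) /\ (forall i, \sum_j p i j = 1).

(* A state [(a, i)] of the restless reformulation records the previous action
   [a] ([true] for action 1, engage; [false] for action 0, rest) and the
   project state [i]. *)
Definition state (N : finType) : finType := (bool * N)%type.

(* Deterministic Markov policies; the action taken may depend on time, as needed
   for the policies that force the action of the initial period. *)
Definition policy (N : finType) := nat -> state N -> bool.

Definition oplus (N : finType) (S0 S1 : {set N}) : {set state N} :=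
  [set x | if x.1 then x.2 \in S1 else x.2 \in S0].

Definition Fhat (N : finType) : {set {set state N}} :=
  [set oplus S.1 S.2 | S : {set N} * {set N} & S.1 \subset S.2].

Definition stationary (N : finType) (S : {set state N}) : policy N :=
  fun _ x => x \in S.

Definition first_then (N : finType) (a : bool) (S : {set state N}) : policy N :=
  fun t x => if t is t'.+1 then stationary S t' x else a.

Section RestlessProject.
Variables (R : realType) (N : finType).
Variables (p : N -> N -> R) (rwd c : N -> R) (beta : R).
Implicit Types (x y : state N) (a : bool) (S : {set state N}) (pi : policy N).

Definition trans x a y : R :=
  if a then (if y.1 then p x.2 y.2 else 0) else (y == (false, x.2))%:R.

Definition stage_reward x a : R :=
  if a then rwd x.2 - (1 - x.1%:R) * c x.2 else 0.

(* Probability of being in state [y] at time [t], starting from [x]. *)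
Fixpoint state_prob pi x (t : nat) y : R :=
  if t is t'.+1 then \sum_z state_prob pi x t' z * trans z (pi t' z) y
  else (y == x)%:R.

(* Expectation of [h (X t) (a t)] under [pi] from [x], where [a t] is the action
   that [pi] takes at time [t] in state [X t]. *)
Definition stage_expectation (h : state N -> bool -> R) pi x (t : nat) : R :=
  \sum_y state_prob pi x t y * h y (pi t y).

(* Since the state space is finite, [h] is bounded and, for [0 < beta < 1], the
   series converges absolutely: its sum is the expectation of the total
   discounted value [\sum_t beta ^+ t * h (X t) (a t)]. *)
Definition discounted_total (h : state N -> bool -> R) pi x : R :=
  limn (series (fun t => beta ^+ t * stage_expectation h pi x t)).

Definition reward_measure pi x : R := discounted_total stage_reward pi x.

Definition work_measure pi x : R := discounted_total (fun _ a => a%:R) pi x.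

Definition marginal_work S x : R :=
  work_measure (first_then true S) x - work_measure (first_then false S) x.

Definition marginal_reward S x : R :=
  reward_measure (first_then true S) x - reward_measure (first_then false S) x.

Definition productivity S x : R := marginal_reward S x / marginal_work S x.

Definition AG_candidates S : {set state N} :=
  [set x | (x \notin S) && (x |: S \in Fhat N)].

Definition AG_argmax S : {set state N} :=
  [set x in AG_candidates S |
    [forall y in AG_candidates S, productivity S y <= productivity S x]].

(* The algorithm is nondeterministic because ties are broken arbitrarily, so its
   runs are described by a relation. A run is the sequence [s] of the picked
   states, indexed from 0: [tnth s k] is the state picked at step [k.+1], and
   [AG_set s k] is the active set built by the first [k] steps. *)
Definition AG_set (s : (2 * #|N|).-tuple (state N)) (k : nat) : {set state N} :=
  [set x in take k s].

Definition AG_run (s : (2 * #|N|).-tuple (state N)) : Prop :=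
  forall k : 'I_(2 * #|N|), tnth s k \in AG_argmax (AG_set s k).

Definition AG_index (s : (2 * #|N|).-tuple (state N)) (k : 'I_(2 * #|N|)) : R :=
  productivity (AG_set s k) (tnth s k).

Definition PCL_indexable : Prop :=
  (forall S x, S \in Fhat N -> 0 < marginal_work S x) /\
  (forall s, AG_run s ->
     forall j k : 'I_(2 * #|N|), (j <= k)%N -> AG_index s k <= AG_index s j).

End RestlessProject.

(* Runs exist, so the monotonicity clause of [PCL_indexable] is not vacuous. *)
Lemma AG_run_exists (R : realType) (N : finType) (p : N -> N -> R)
    (rwd c : N -> R) (beta : R) : exists s, AG_run p rwd c beta s.
Proof.
pose picks (s : seq (state N)) := forall x0 k, (k < size s)%N ->
  nth x0 s k \in AG_argmax p rwd c beta [set x in take k s].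
have cand S : S \in Fhat N -> (#|S| < 2 * #|N|)%N ->
    exists x, x \in AG_candidates S.
  case/imsetP => -[S0 S1]; rewrite inE /= => sub -> ltS.
  have [T1|/set0Pn[i]] := eqVneq (~: S1) set0.
    have {}T1 : S1 = [set: N] by rewrite -[S1]setCK T1 setC0.
    have [T0|/set0Pn[i]] := eqVneq (~: S0) set0.
      have {}T0 : S0 = [set: N] by rewrite -[S0]setCK T0 setC0.
      suff E : oplus S0 S1 = [set: state N].
        by move: ltS; rewrite E cardsT card_prod card_bool ltnn.
      by apply/setP => -[[] j]; rewrite ?T0 ?T1 !inE.
    rewrite inE => iS0; exists (false, i); rewrite !inE /= iS0 /=.
    apply/imsetP; exists (i |: S0, S1) => //; first by rewrite T1 inE subsetT.
    by apply/setP => -[[] j]; rewrite !inE.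
  rewrite inE => iS1; exists (true, i); rewrite !inE /= iS1 /=.
  apply/imsetP; exists (S0, i |: S1) => //.
    by rewrite inE (subset_trans sub) // subsetUr.
  by apply/setP => -[[] j]; rewrite !inE.
have step m : (m <= 2 * #|N|)%N ->
    exists s, [/\ size s = m, [set x in s] \in Fhat N & picks s].
  elim: m => [_|m IH ltm].
    exists [::]; split => //; apply/imsetP; exists (set0, set0) => //.
      by rewrite inE sub0set.
    by apply/setP => -[[] j]; rewrite !inE.
  have [s [ss sF sP]] := IH (ltnW ltm).
  have [|x0 x0c] := cand _ sF.
    by rewrite cardsE (leq_ltn_trans (card_size _)) // ss.
  have [x xc xmax] := arg_maxP
    (fun x => productivity p rwd c beta [set x in s] x) x0c.
  have {}xc : x \in AG_candidates [set z in s] by [].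
  exists (rcons s x); split; first by rewrite size_rcons ss.
    have -> : [set y in rcons s x] = x |: [set y in s].
      by apply/setP => y; rewrite !inE mem_rcons inE.
    by move: xc; rewrite inE => /andP[].
  move=> y0 k; rewrite size_rcons ltnS leq_eqVlt => /orP[/eqP->|ltk].
    rewrite nth_rcons ltnn eqxx -cats1 take_size_cat // inE xc /=.
    by apply/forallP => y; apply/implyP; exact: xmax.
  by rewrite nth_rcons ltk -cats1 takel_cat ?(ltnW ltk) //; exact: sP.
have [s [ss _ sP]] := step _ (leqnn _).
have sz : size s == (2 * #|N|)%N by rewrite ss.
exists (Tuple sz) => k; rewrite (tnth_nth (tnth (Tuple sz) k)).
by apply: sP; rewrite ss.
Qed.

(* Main.v *)
(** Let [A i] and [B i] be the discounted reward and work of engaging in [i] when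
    already set up and then following an active set [S0 (+) S1] with [S0]
    included in [S1]. A rested project that is not in [S0] stays at rest forever,
    so both solve [A = rwd + beta p (1_{S1} A)], [B = 1 + beta p (1_{S1} B)] and
    depend on [S1] only. The marginal work at [(a, i)] is [B i], times
    [1 - beta] if [i] is in [S0], hence positive. Every candidate of the
    algorithm has [i] outside [S0], and its index is
    [(A i - (1 - a) c i) / B i]. Adding [(0, i)] leaves [A], [B] unchanged and
    creates no candidate. Adding [(1, i)] with index [m = A i / B i] leaves
    [A - m B] unchanged, because this function vanishes at [i]; so no old
    candidate rises above [m], and the new candidate [(0, i)] has index at most
    [m] because [c i >= 0]. *)

Require Import Defs.
From mathcomp Require Import all_boot all_order all_algebra.
From mathcomp Require Import reals.
From mathcomp Require Import boolp topology normedtype sequences.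
From mathcomp Require Import ring lra.

Set Implicit Arguments.
Unset Strict Implicit.
Unset Printing Implicit Defensive.

Import Order.TTheory GRing.Theory Num.Theory.
Import numFieldNormedType.Exports.
Local Open Scope ring_scope.

(** * First-step analysis of the state distribution *)

Section StateProbabilities.
Context (R : realType) (N : finType) (p : N -> N -> R).
Implicit Types (x y : state N) (pi : policy N).

Lemma sum_trans_true x (V : state N -> R) :
  \sum_y trans p x true y * V y = \sum_j p x.2 j * V (true, j).
Proof.
rewrite (eq_bigr (fun y => trans p x true (y.1, y.2) * V (y.1, y.2)));
  last by case.
rewrite -(pair_bigA _ (fun a i => trans p x true (a, i) * V (a, i))) /=.
rewrite big_bool /= [X in _ + X]big1 ?addr0 // => i _.
by rewrite /trans /= mul0r.
Qed.

Lemma sum_trans_false x (V : state N -> R) :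
  \sum_y trans p x false y * V y = V (false, x.2).
Proof.
rewrite (bigD1 (false, x.2)) //= /trans eqxx mul1r big1 ?addr0 // => y.
by move=> /negPf ->; rewrite mul0r.
Qed.

(** [state_prob] recurses on the last transition; the Bellman equation needs the first one split off
    instead. *)
Lemma state_prob_first_step pi x t y :
  state_prob p pi x t.+1 y =
  \sum_z trans p x (pi 0 x) z * state_prob p (fun s => pi s.+1) z t y.
Proof.
elim: t y => [|t IH] y.
  rewrite /= (bigD1 x) //= eqxx mul1r big1 ?addr0; last first.
    by move=> z /negPf ->; rewrite mul0r.
  rewrite (bigD1 y) //= eqxx mulr1 big1 ?addr0 // => z.
  by rewrite eq_sym => /negPf ->; rewrite mulr0.
rewrite [LHS]/=; under eq_bigr => w _ do rewrite [X in X * _]IH mulr_suml.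
rewrite exchange_big; apply: eq_bigr => z _ /=.
by rewrite mulr_sumr; apply: eq_bigr => w _; rewrite mulrA.
Qed.

Lemma stage_expectation_first_step h pi x t :
  stage_expectation p h pi x t.+1 =
  \sum_z trans p x (pi 0 x) z * stage_expectation p h (fun s => pi s.+1) z t.
Proof.
rewrite /stage_expectation.
under eq_bigr => y _ do rewrite state_prob_first_step mulr_suml.
rewrite exchange_big; apply: eq_bigr => z _ /=.
by rewrite mulr_sumr; apply: eq_bigr => w _; rewrite mulrA.
Qed.

Lemma stage_expectation0 h pi x : stage_expectation p h pi x 0 = h x (pi 0 x).
Proof.
rewrite /stage_expectation (bigD1 x) //= eqxx mul1r big1 ?addr0 // => y.
by move=> /negPf ->; rewrite mul0r.
Qed.

Hypothesis hp : stochastic p.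

Lemma trans_ge0 x a y : 0 <= trans p x a y.
Proof. by rewrite /trans; case: a => //; case: ifP => // _; apply: hp.1. Qed.

Lemma sum_trans x a : \sum_y trans p x a y = 1.
Proof.
under eq_bigr => y _ do rewrite -[trans _ _ _ _]mulr1.
case: a; rewrite ?(sum_trans_true _ (fun=> 1)) ?(sum_trans_false _ (fun=> 1)) //.
by under eq_bigr => j _ do rewrite mulr1; exact: hp.2.
Qed.

Lemma state_prob_ge0 pi x t y : 0 <= state_prob p pi x t y.
Proof.
elim: t y => [|t IH] y /=; first by rewrite ler0n.
by apply: sumr_ge0 => z _; rewrite mulr_ge0 ?trans_ge0.
Qed.

Lemma sum_state_prob pi x t : \sum_y state_prob p pi x t y = 1.
Proof.
elim: t => [|t IH] /=.
  by rewrite (bigD1 x) //= eqxx big1 ?addr0 // => y /negPf ->.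
rewrite exchange_big -[RHS]IH; apply: eq_bigr => z _ /=.
by rewrite -mulr_sumr sum_trans mulr1.
Qed.

Lemma state_prob_le1 pi x t y : state_prob p pi x t y <= 1.
Proof.
rewrite -(sum_state_prob pi x t) (bigD1 y) //= lerDl.
by apply: sumr_ge0 => z _; apply: state_prob_ge0.
Qed.

(** The bound does not depend on [t], so a geometric series dominates the discounted one. *)
Lemma stage_expectation_bound h pi x t :
  `|stage_expectation p h pi x t| <= \sum_y (`|h y true| + `|h y false|).
Proof.
apply: (le_trans (ler_norm_sum _ _ _)); apply: ler_sum => y _.
rewrite normrM ger0_norm ?state_prob_ge0 //.
apply: (@le_trans _ _ `|h y (pi t y)|).
  by rewrite ler_piMl ?state_prob_le1.
by case: (pi t y); rewrite (lerDl, lerDr).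
Qed.

End StateProbabilities.

(** * Bellman equation and uniqueness of fixed points *)

Section DiscountedTotal.
Context (R : realType) (N : finType) (p : N -> N -> R) (beta : R).
Hypotheses (hp : stochastic p) (hbeta : 0 < beta < 1).
Implicit Types (x y : state N) (pi : policy N).

Let term h pi x t := beta ^+ t * stage_expectation p h pi x t.

Let beta_ge0 : 0 <= beta. Proof. by case/andP: hbeta => /ltW. Qed.

Lemma cvg_discounted_series h pi x : cvgn (series (term h pi x)).
Proof.
apply: normed_cvg; set M := \sum_y (`|h y true| + `|h y false|).
apply: (@series_le_cvg _ _ (geometric M beta)) => [t|t|t|].
- exact: normr_ge0.
- by rewrite /geometric /= mulr_ge0 ?exprn_ge0 ?sumr_ge0 // => y _; apply: addr_ge0.
- rewrite /term /geometric /= normrM ger0_norm ?exprn_ge0 // mulrC.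
  by rewrite ler_wpM2r ?exprn_ge0 // stage_expectation_bound.
- by apply: is_cvg_geometric_series; rewrite ger0_norm //; case/andP: hbeta.
Qed.

Lemma discounted_total_first_step h pi x :
  discounted_total p beta h pi x =
  h x (pi 0 x) + beta * \sum_y trans p x (pi 0 x) y *
                          discounted_total p beta h (fun t => pi t.+1) y.
Proof.
(* After the shift, partial sum [n.+1] is the initial stage plus [beta] times the averaged partial
   sums of length [n] for the shifted policy; the finite average passes to the limit. *)
apply: cvg_lim => //; rewrite -(cvg_shiftS (series _)) /=.
rewrite (_ : (fun n => _) = fun n => h x (pi 0 x) +
   beta * \sum_y trans p x (pi 0 x) y * series (term h (fun t => pi t.+1) y) n).
  apply: cvgD; first exact: cvg_cst.
  apply: cvgMl_tmp; apply: cvg_big => [|y _]; first exact: add_continuous.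
  apply: cvgMl_tmp.
  exact: cvg_discounted_series.
apply/funext => n; rewrite /series /= big_nat_recl //= expr0 mul1r.
rewrite stage_expectation0; congr (_ + _).
under eq_bigr => t _ do rewrite stage_expectation_first_step exprS -mulrA mulr_sumr.
rewrite -mulr_sumr exchange_big; congr (_ * _); apply: eq_bigr => y _ /=.
by rewrite mulr_sumr; apply: eq_bigr => t _; rewrite /term mulrCA.
Qed.

Lemma discounted_total_ge0 h pi x :
  (forall y a, 0 <= h y a) -> 0 <= discounted_total p beta h pi x.
Proof.
move=> h0; apply: limr_ge; first exact: cvg_discounted_series.
apply: nearW => n; apply: sumr_ge0 => t _.
rewrite mulr_ge0 ?exprn_ge0 //; apply: sumr_ge0 => y _.
by rewrite mulr_ge0 ?state_prob_ge0.
Qed.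

(** Contraction in the sup norm: the weights over [T] sum to at most 1, so a maximiser [m] of
    [e = |u - v|] satisfies [e m <= beta * e m], which forces the maximum to be 0. *)
Lemma substochastic_fixpoint_unique (b : N -> R) (T : {set N}) (u v : N -> R) :
  (forall i, u i = b i + beta * \sum_(j in T) p i j * u j) ->
  (forall i, v i = b i + beta * \sum_(j in T) p i j * v j) ->
  u =1 v.
Proof.
move=> hu hv i; apply/eqP; rewrite -subr_eq0 -normr_le0.
pose e j := `|u j - v j|.
have [m _ hm] := arg_maxP e (erefl (xpredT i)).
apply: le_trans (hm i isT) _.
have le_em : e m <= beta * e m.
  rewrite {1}/e hu hv opprD addrACA subrr add0r -mulrBr -sumrB.
  rewrite normrM ger0_norm //; apply: ler_wpM2l => //.
  apply: (le_trans (ler_norm_sum _ _ _)).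
  rewrite -[leRHS]mul1r -(hp.2 m) mulr_suml big_mkcond ler_sum // => j _.
  have pe_ge0 : 0 <= p m j * e m by rewrite mulr_ge0 ?normr_ge0 ?hp.1.
  case: ifP => // _; rewrite -mulrBr normrM ger0_norm ?hp.1 //.
  by apply: ler_wpM2l; [exact: hp.1 | exact: hm].
have : (1 - beta) * e m <= 0 by rewrite mulrBl mul1r subr_le0.
by rewrite pmulr_rle0 // subr_gt0; case/andP: hbeta.
Qed.

End DiscountedTotal.

(** [S0] and [S1] are recovered as slices of [S], which turns feasibility into a pointwise condition
    that is easy to test on insertions. *)
Lemma FhatP (N : finType) (S : {set state N}) :
  reflect (forall i, (false, i) \in S -> (true, i) \in S) (S \in Fhat N).
Proof.
apply: (iffP imsetP) => [[[S0 S1]] /[!inE] /= /subsetP sub -> i|sub].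
  by rewrite !inE; exact: sub.
exists ([set i | (false, i) \in S], [set i | (true, i) \in S]).
  by rewrite inE; apply/subsetP => i; rewrite !inE; exact: sub.
by apply/setP => -[[] i]; rewrite !inE.
Qed.

(** * Closed forms for marginal reward, marginal work and the index *)

Section Marginals.
Context (R : realType) (N : finType) (p : N -> N -> R) (beta : R).
Hypotheses (hp : stochastic p) (hbeta : 0 < beta < 1).
Implicit Types (rwd c : N -> R) (S : {set state N}) (i j : N) (a : bool).

Definition engaged_value rwd c S i : R :=
  rwd i + beta * \sum_j p i j *
            reward_measure p rwd c beta (stationary S) (true, j).

(** Only the tail of [pi] is required to be stationary, so this covers both [stationary S] and
    [first_then true S]. *)
Lemma reward_measure_engage rwd c S a pi i :
  pi 0 (a, i) = true -> (fun t => pi t.+1) = stationary S ->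
  reward_measure p rwd c beta pi (a, i) =
  engaged_value rwd c S i - (1 - a%:R) * c i.
Proof.
move=> pi0 piS; rewrite /reward_measure discounted_total_first_step // pi0 piS.
by rewrite sum_trans_true /= addrAC.
Qed.

Lemma reward_measure_rest rwd c S a pi i :
  pi 0 (a, i) = false -> (fun t => pi t.+1) = stationary S ->
  reward_measure p rwd c beta pi (a, i) =
  beta * reward_measure p rwd c beta (stationary S) (false, i).
Proof.
move=> pi0 piS; rewrite /reward_measure discounted_total_first_step // pi0 piS.
by rewrite sum_trans_false /= add0r.
Qed.

Lemma reward_measure_stationary rwd c S a i : S \in Fhat N ->
  reward_measure p rwd c beta (stationary S) (a, i) =
  if (a, i) \in S then engaged_value rwd c S i - (1 - a%:R) * c i else 0.
Proof.
move=> /FhatP SF; case: ifPn => [aiS|aiS]; first exact: reward_measure_engage.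
(* Resting in [(false, i)] earns nothing and returns to the same state, so the value solves
   [v = beta * v] and vanishes because [beta < 1]. *)
have rest0 : (false, i) \notin S ->
    reward_measure p rwd c beta (stationary S) (false, i) = 0.
  move=> /negPf fiS.
  have := @reward_measure_rest rwd c S false (stationary S) i fiS erefl.
  by move: (reward_measure _ _ _ _ _ _) => v; case/andP: hbeta; nra.
rewrite (@reward_measure_rest rwd c S) //; last exact/negbTE.
rewrite rest0 ?mulr0 //; case: a aiS => // aiS.
by apply: contra aiS; exact: SF.
Qed.

(** After engaging, the project is set up: the next state either earns its engaged value without
    startup cost or, outside [S], earns 0 forever. *)
Lemma engaged_valueE rwd c S i : S \in Fhat N ->
  engaged_value rwd c S i =
  rwd i + beta * \sum_(j in [set k | (true, k) \in S])
                    p i j * engaged_value rwd c S j.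
Proof.
move=> SF; rewrite {1}/engaged_value [in RHS]big_mkcond; congr (_ + _ * _).
apply: eq_bigr => j _; rewrite reward_measure_stationary // inE subrr mul0r subr0.
by case: ifP => // _; rewrite mulr0.
Qed.

Lemma marginal_rewardE rwd c S a i : S \in Fhat N ->
  marginal_reward p rwd c beta S (a, i) =
  engaged_value rwd c S i - (1 - a%:R) * c i -
  beta * (if (false, i) \in S then engaged_value rwd c S i - c i else 0).
Proof.
move=> SF; rewrite /marginal_reward (@reward_measure_engage rwd c S) //.
rewrite (@reward_measure_rest rwd c S) //.
by rewrite reward_measure_stationary // subr0 mul1r.
Qed.

(* Work is the reward of the project with unit active rewards and no startup
   costs, so every formula for rewards specializes to work. *)
Lemma marginal_work_reward S x :
  marginal_work p beta S x =
  marginal_reward p (fun=> 1) (fun=> 0) beta S x.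
Proof.
rewrite /marginal_work /marginal_reward /work_measure /reward_measure.
suff -> : (fun (_ : state N) (a : bool) => a%:R : R) =
          stage_reward (fun=> 1) (fun=> 0) by [].
apply/funext => y; apply/funext => -[] //.
by rewrite /stage_reward mulr0 subr0.
Qed.

Definition engaged_work S i := engaged_value (fun=> 1) (fun=> 0) S i.

Lemma engaged_work_gt0 S i : 0 < engaged_work S i.
Proof.
apply: ltr_pwDl => //; apply: mulr_ge0; first by case/andP: hbeta => /ltW.
apply: sumr_ge0 => j _; apply: mulr_ge0; first exact: hp.1.
apply: discounted_total_ge0 => // y [] //.
by rewrite /stage_reward mulr0 subr0.
Qed.

Lemma marginal_work_gt0 S x : S \in Fhat N -> 0 < marginal_work p beta S x.
Proof.
case: x => a i SF; rewrite marginal_work_reward marginal_rewardE //.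
rewrite mulr0 !subr0 -/(engaged_work S i); have := engaged_work_gt0 S i.
by move: (engaged_work S i) => w w0; case/andP: hbeta => ? ?; case: ifP => _; nra.
Qed.

Lemma productivityE rwd c S a i : S \in Fhat N -> (false, i) \notin S ->
  productivity p rwd c beta S (a, i) =
  (engaged_value rwd c S i - (1 - a%:R) * c i) / engaged_work S i.
Proof.
move=> SF /negPf iS; rewrite /productivity marginal_work_reward.
by rewrite !marginal_rewardE // iS mulr0 !subr0 mulr0 subr0.
Qed.

(** The fixed-point equation reads only the slice of [S] at [true], which this insertion does not
    touch. *)
Lemma engaged_value_insert_rest rwd c S i : S \in Fhat N ->
  (false, i) |: S \in Fhat N ->
  engaged_value rwd c ((false, i) |: S) =1 engaged_value rwd c S.
Proof.
move=> SF SF'.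
apply: (@substochastic_fixpoint_unique _ _ p beta hp hbeta rwd
          [set k | (true, k) \in S]) => j; last exact: engaged_valueE.
rewrite [LHS]engaged_valueE //; congr (_ + _ * _).
by apply: eq_bigl => k; rewrite !inE.
Qed.

(* Both sides solve the fixed-point equation of the enlarged set: the added
   summand vanishes because [m] is the index of [i]. *)
Lemma priced_value_insert_engage rwd c S i (m : R) : S \in Fhat N ->
  (true, i) |: S \in Fhat N -> (true, i) \notin S ->
  engaged_value rwd c S i = m * engaged_work S i ->
  forall j, engaged_value rwd c ((true, i) |: S) j -
              m * engaged_work ((true, i) |: S) j =
            engaged_value rwd c S j - m * engaged_work S j.
Proof.
move=> SF SF' iS hm.
(* By linearity, charging [m] per unit of work gives the same equation with active rewards
   [rwd - m]. *)
have priced T j : T \in Fhat N ->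
    engaged_value rwd c T j - m * engaged_work T j =
    (rwd j - m) + beta * \sum_(k in [set k | (true, k) \in T])
                 p j k * (engaged_value rwd c T k - m * engaged_work T k).
  move=> TF; under eq_bigr => k _ do rewrite mulrBr (mulrCA _ m).
  rewrite sumrB -mulr_sumr /engaged_work [in LHS]engaged_valueE //.
  rewrite [in X in _ - X = _]engaged_valueE //; ring.
apply: (@substochastic_fixpoint_unique _ _ p beta hp hbeta (fun j => rwd j - m)
          [set k | (true, k) \in (true, i) |: S]) => j; first exact: priced.
rewrite {1}priced // [in RHS](bigD1 i) /=; last by rewrite !inE eqxx.
rewrite hm subrr mulr0 add0r; congr (_ + _ * _).
apply: eq_bigl => k; rewrite !inE.
rewrite xpair_eqE /=; have [->|//] := eqVneq k i; first by rewrite (negPf iS).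
by rewrite andbT.
Qed.

End Marginals.

(** * Monotonicity of the index along a run *)

Section Run.
Context (R : realType) (N : finType) (p : N -> N -> R) (rwd c : N -> R) (beta : R).
Hypotheses (hp : stochastic p) (hc : forall i, 0 <= c i) (hbeta : 0 < beta < 1).
Implicit Types (S : {set state N}) (x y : state N).

Lemma candidate_notin_rest S a i : S \in Fhat N ->
  (a, i) \in AG_candidates S -> (false, i) \notin S.
Proof.
move=> /FhatP SF; rewrite inE => /andP[].
by case: a => // + _; apply: contra; exact: SF.
Qed.

(** Clearing the positive denominator replaces the ratio by the value priced at [m], the quantity
    that insertions preserve. *)
Lemma productivity_le S a i (m : R) : S \in Fhat N -> (false, i) \notin S ->
  (productivity p rwd c beta S (a, i) <= m) =
  (engaged_value p beta rwd c S i - m * engaged_work p beta S i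
     <= (1 - a%:R) * c i).
Proof.
move=> SF iS; rewrite productivityE // ler_pdivrMr ?engaged_work_gt0 //.
by rewrite lerBlDr lerBlDr addrC.
Qed.

Lemma productivity_step S x y : S \in Fhat N ->
  x \in AG_argmax p rwd c beta S -> y \in AG_candidates (x |: S) ->
  productivity p rwd c beta (x |: S) y <= productivity p rwd c beta S x.
Proof.
move=> SF; rewrite inE => /andP[xS /forallP /(_ _)/implyP xmax].
case: y => b j yS'.
have /FhatP Srest := SF.
have SF' : x |: S \in Fhat N by move: xS; rewrite inE => /andP[].
have jS' := candidate_notin_rest SF' yS'.
have jS : (false, j) \notin S by apply: contra jS'; rewrite inE orbC => ->.
have iS : (false, x.2) \notin S.
  by move: xS; case: (x) => a i; apply: candidate_notin_rest.
set m := productivity p rwd c beta S x in xmax *.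
(* Either kind of pick preserves the value priced at [m], so the bound can be tested on the old
   set. *)
have price_eq :
    engaged_value p beta rwd c (x |: S) j - m * engaged_work p beta (x |: S) j =
    engaged_value p beta rwd c S j - m * engaged_work p beta S j.
  case: x xS @m xmax yS' SF' jS' iS => -[] i xS m xmax yS' SF' jS' iS.
    apply: priced_value_insert_engage => //; first by move: xS; rewrite inE => /andP[].
    rewrite /m productivityE // subrr mul0r subr0 divfK //.
    by rewrite gt_eqF // engaged_work_gt0.
  by rewrite /engaged_work !engaged_value_insert_rest.
rewrite productivity_le // price_eq.
have [yS|yS] := boolP ((b, j) \in AG_candidates S).
  by rewrite -productivity_le //; exact: xmax.
(* Only engaging [j] at the previous step can make [(b, j)] a new candidate. *)
have [xj bj] : x = (true, j) /\ b = false.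
  move: yS' yS; rewrite !inE negb_or => /andP[/andP[bjx bjS] bjF'].
  rewrite bjS /=; case: b bjx bjS bjF' => bjx bjS bjF' bjF.
    case/negP: bjF; apply/FhatP => k; rewrite !inE /= => kS.
    by rewrite (Srest _ kS) orbT.
  split=> //; apply/eqP; apply: contraNT bjF => xj.
  apply/FhatP => k; rewrite !inE /= xpair_eqE /= => /orP[/eqP->|/Srest //].
  move/FhatP: bjF' => /(_ j); rewrite !inE eqxx /= => /(_ isT).
  by rewrite eq_sym (negPf xj).
rewrite bj subr0 mul1r; apply: le_trans (hc j).
(* As [m] is the index of [(true, j)] itself, [m <= m] says that the priced value at [j] is at most
   0. *)
have := lexx m; rewrite {1}/m xj productivity_le //.
by rewrite subrr mul0r.
Qed.

Lemma AG_setS (s : (2 * #|N|).-tuple (state N)) (k : 'I_(2 * #|N|)) :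
  AG_set s k.+1 = tnth s k |: AG_set s k.
Proof.
apply/setP => y; rewrite !inE (take_nth (tnth s k)) ?size_tuple //.
by rewrite mem_rcons inE -tnth_nth.
Qed.

Lemma AG_set_Fhat s k : AG_run p rwd c beta s ->
  (k <= 2 * #|N|)%N -> AG_set s k \in Fhat N.
Proof.
move=> run; case: k => [_|k ltk].
  by apply/FhatP => i; rewrite /AG_set take0 !inE.
have := run (Ordinal ltk); rewrite (AG_setS s (Ordinal ltk)) !inE.
by case/andP => /andP[].
Qed.

Lemma AG_index_nonincreasing s : AG_run p rwd c beta s ->
  forall j k : 'I_(2 * #|N|), (j <= k)%N ->
  AG_index p rwd c beta s k <= AG_index p rwd c beta s j.
Proof.
move=> run j [k ltk] /= lejk.
elim: k ltk lejk => [|k IH] ltk lejk.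
  by rewrite (_ : Ordinal ltk = j) //; apply/val_inj/eqP; rewrite eq_sym -leqn0.
move: lejk; rewrite leq_eqVlt => /orP[/eqP ejk|].
  by rewrite (_ : Ordinal ltk = j) //; apply/val_inj.
rewrite ltnS => lejk; apply: le_trans (IH (ltnW ltk) lejk).
have := run (Ordinal ltk); rewrite inE => /andP[+ _].
rewrite /AG_index /= (AG_setS s (Ordinal (ltnW ltk))).
apply: productivity_step (run _).
exact: (AG_set_Fhat run (ltnW (ltnW ltk))).
Qed.

End Run.

Theorem theorem4p9 (R : realType) (N : finType) (p : N -> N -> R)
    (rwd c : N -> R) (beta : R)
    (hp : stochastic p) (hc : forall i, 0 <= c i) (hbeta : 0 < beta < 1) :
  PCL_indexable p rwd c beta.
Proof.
split=> [S x SF|s run]; first exact: marginal_work_gt0.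
exact: AG_index_nonincreasing.
Qed.
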